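(* Let $W$ be the Weyl group of type $A_n$ and $\widetilde{W}$ its affine Weyl group. The map sending $w\in\widetilde{W}^S$ to the sequence of index pairs $((i_1,j_1),\dots,(i_p,j_p))$ of its canonical factorization $r(w)=C_{i_1,j_1}C_{i_2,j_2}\cdots C_{i_p,j_p}$ is a bijection from $\widetilde{W}^S$ onto the set of allowed products of segments, i.e. finite sequences of pairs $(i_t,j_t)$ with $0\le i_t\le n$, $1\le j_t\le n$ such that every consecutive pair $C_{i_t,j_t}C_{i_{t+1},j_{t+1}}$ is an allowed pair; moreover it is length preserving: $\ell(w)=\sum_t(i_t+j_t)$.
   Context: $\widetilde{W}$ is the affine symmetric group with Coxeter generators $s_0,\dots,s_n$ indexed mod $n+1$ ($m(s_a,s_b)=3$ if $a-b\equiv\pm1 \pmod{n+1}$, else $2$, for $n\ge2$; $m(s_0,s_1)=\infty$ for $n=1$). $W=W_S$, $S=\{s_1,\dots,s_n\}$; $\widetilde{W}^S$ is the set of minimal length left coset representatives of $W$. Segments: $C_{i,j}=s_i\cdots s_1\, s_{n-j+2}\cdots s_n\, s_0$ for $0\le i\le n$, $1\le j\le n$ (blocks empty when $i=0$, resp. $j=1$), of length $i+j$. Canonical factorization: $r(\mathrm{id})$ is empty; for $w\in\widetilde{W}^S\setminus\{\mathrm{id}\}$, write $ws_0=uv$ uniquely with $u\in\widetilde{W}^S$, $v\in W$, $\ell(ws_0)=\ell(u)+\ell(v)$; then $vs_0=C_{i,j}$ for a unique pair $(i,j)$ (the elements $s_i\cdots s_1s_{n-j+2}\cdots s_n$ are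 exactly the minimal length representatives of $W/W_{\{s_2,\dots,s_{n-1}\}}$), and $r(w)=r(u)\,C_{i,j}$. The pair $C_{i,j}C_{k,l}$ is allowed if at least one holds: ($i<k$ and $j<l$); ($k+l>n$, $i<k$, $j\le l$); ($i+j>n$, $i\le k$, $j\le l$). *)

(* Defs.v *)
From HB Require Import structures.
From mathcomp Require Import all_boot.
From mathcomp Require Import boolp classical_sets functions.

Set Implicit Arguments.
Unset Strict Implicit.
Unset Printing Implicit Defensive.

Local Open Scope classical_set_scope.
Local Open Scope group_scope.

Section CoxeterGroup.
Variables (I : choiceType) (m : I -> I -> nat).

(* The congruence on words generated by the Coxeter relations s_i^2 = 1 and
   (s_i s_j)^(m i j) = 1.  The value m i j = 0 stands for infinity: the
   corresponding relation is then the trivial one. *)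
Inductive coxeq : seq I -> seq I -> Prop :=
| coxeq_refl u : coxeq u u
| coxeq_sym u v : coxeq u v -> coxeq v u
| coxeq_trans u v w : coxeq u v -> coxeq v w -> coxeq u w
| coxeq_cat u u' v v' : coxeq u u' -> coxeq v v' -> coxeq (u ++ v) (u' ++ v')
| coxeq_sq i : coxeq [:: i; i] [::]
| coxeq_braid i j : coxeq (flatten (nseq (m i j) [:: i; j])) [::].

Definition coxeqb : rel (seq I) := fun u v => `[< coxeq u v >].

Lemma coxeqb_refl : reflexive coxeqb.
Proof. by move=> u; apply/asboolP; apply: coxeq_refl. Qed.

Lemma coxeqb_sym : symmetric coxeqb.
Proof. by move=> u v; apply/asboolP/asboolP; apply: coxeq_sym. Qed.

Lemma coxeqb_trans : transitive coxeqb.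
Proof.
move=> v u w /asboolP uv /asboolP vw; apply/asboolP; exact: coxeq_trans uv vw.
Qed.

Canonical coxeqb_equiv := EquivRel coxeqb coxeqb_refl coxeqb_sym coxeqb_trans.

Definition coxgroup := {eq_quot coxeqb}%qT.
HB.instance Definition _ := Choice.on coxgroup.
HB.instance Definition _ := EqQuotient.on coxgroup.

Definition coxword (u : seq I) : coxgroup := (\pi_coxgroup u)%qT.

Lemma coxwordP u v : coxword u = coxword v <-> coxeq u v.
Proof. by split=> [/eqmodP/asboolP|?] //; apply/eqmodP/asboolP. Qed.

Lemma coxword_surj g : exists u, coxword u = g.
Proof. by exists (repr g); rewrite /coxword reprK. Qed.

Definition coxone : coxgroup := coxword [::].
Definition coxmul (g h : coxgroup) : coxgroup := coxword (repr g ++ repr h).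
Definition coxinv (g : coxgroup) : coxgroup := coxword (rev (repr g)).

Lemma repr_coxword u : coxeq (repr (coxword u)) u.
Proof. by apply/coxwordP; rewrite /coxword reprK. Qed.

Lemma coxmulE u v : coxmul (coxword u) (coxword v) = coxword (u ++ v).
Proof. by apply/coxwordP/coxeq_cat; apply: repr_coxword. Qed.

Lemma coxmulA : associative coxmul.
Proof.
move=> x y z; have [u <-] := coxword_surj x; have [v <-] := coxword_surj y.
by have [w <-] := coxword_surj z; rewrite !coxmulE catA.
Qed.

Lemma coxmul1g : left_id coxone coxmul.
Proof. by move=> x; have [u <-] := coxword_surj x; rewrite coxmulE. Qed.

Lemma coxmulg1 : right_id coxone coxmul.
Proof. by move=> x; have [u <-] := coxword_surj x; rewrite coxmulE cats0. Qed.

Lemma coxeq_revl u : coxeq (rev u ++ u) [::].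
Proof.
elim: u => [|i u IH]; first exact: coxeq_refl.
rewrite rev_cons cat_rcons; apply: coxeq_trans IH.
apply: coxeq_cat; first exact: coxeq_refl.
have := coxeq_cat (coxeq_sq i) (coxeq_refl u); exact.
Qed.

Lemma coxmulVg : left_inverse coxone coxinv coxmul.
Proof.
move=> x; rewrite -{2}[x]reprK coxmulE; apply/coxwordP; exact: coxeq_revl.
Qed.

Lemma coxmulgV : right_inverse coxone coxinv coxmul.
Proof.
move=> x; rewrite -{1}[x]reprK coxmulE; apply/coxwordP.
by rewrite -{1}[repr x]revK; exact: coxeq_revl.
Qed.

HB.instance Definition _ := isGroup.Build coxgroup
  coxmulA coxmul1g coxmulg1 coxmulVg coxmulgV.

Definition coxgen (i : I) : coxgroup := coxword [:: i].

Lemma coxwordE u : coxword u = \prod_(i <- u) coxgen i.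
Proof.
elim: u => [|i u IH]; first by rewrite big_nil.
by rewrite big_cons -IH; symmetry; apply: (coxmulE [:: i]).
Qed.

Lemma coxlen_subproof (g : coxgroup) :
  exists k, `[< exists2 u : seq I, size u = k & \prod_(i <- u) coxgen i = g >].
Proof.
have [u <-] := coxword_surj g; exists (size u); apply/asboolP.
by exists u; rewrite ?coxwordE.
Qed.

Definition coxlen (g : coxgroup) : nat := ex_minn (coxlen_subproof g).

Definition parabolic (J : set I) : set coxgroup :=
  [set g | exists2 u : seq I,
     (forall i, i \in u -> J i) & \prod_(i <- u) coxgen i = g].

(* left cosets are the g W_J *)
Definition min_left_reps (J : set I) : set coxgroup :=
  [set g | forall v, parabolic J v -> coxlen g <= coxlen (g * v)].

End CoxeterGroup.
Arguments parabolic {I} m J.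
Arguments min_left_reps {I} m J.

(* Affine type A_n; for n = 1 the bond is infinite, encoded by 0. *)
Definition affA_mx (n : nat) (a b : 'I_n.+1) : nat :=
  if a == b then 1%N
  else if (a == b.+1 %[mod n.+1]) || (b == a.+1 %[mod n.+1]) then
    (if n == 1%N then 0%N else 3%N)
  else 2%N.

Notation affW n := (coxgroup (@affA_mx n)).

Section Affine.
Variable n : nat.

Definition s_ (k : nat) : affW n := coxgen (@affA_mx n) (inord k).

Definition finS : set 'I_n.+1 := [set a | a != ord0].
Definition finW : set (affW n) := parabolic (@affA_mx n) finS.
Definition affWS : set (affW n) := min_left_reps (@affA_mx n) finS.
Definition len : affW n -> nat := @coxlen _ (@affA_mx n).

(* s_i ... s_1 * s_{n-j+2} ... s_n * s_0 *)
Definition segment (i j : nat) : affW n :=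
  (\prod_(k <- rev (iota 1 i)) s_ k) *
  (\prod_(n - j + 2 <= k < n.+1) s_ k) * s_ 0.

Definition segment_index (p : nat * nat) : bool :=
  ((p.1 <= n) && (1 <= p.2 <= n))%N.

Inductive is_canonical : affW n -> seq (nat * nat) -> Prop :=
| is_canonical_id : is_canonical 1 [::]
| is_canonical_step (w u v : affW n) (i j : nat) (r : seq (nat * nat)) :
    affWS w -> w != 1 ->
    affWS u -> finW v -> w * s_ 0 = u * v ->
    len (w * s_ 0) = (len u + len v)%N ->
    segment_index (i, j) -> v * s_ 0 = segment i j ->
    is_canonical u r -> is_canonical w (rcons r (i, j)).

(* The relation is functional on affWS, so the choice made by xget is forced. *)
Definition canonical_factorization (w : affW n) : seq (nat * nat) :=
  xget [::] [set r | is_canonical w r].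

Definition allowed_pair : rel (nat * nat) := fun p q =>
  let: (i, j) := p in let: (k, l) := q in
  [|| (i < k) && (j < l),
      [&& n < k + l, i < k & j <= l]
    | [&& n < i + j, i <= k & j <= l]].

Definition allowed_products : set (seq (nat * nat)) :=
  [set r | all segment_index r && sorted allowed_pair r].

End Affine.

(* Main.v *)
Require Import Defs.
From HB Require Import structures.
From mathcomp Require Import all_boot order ssralg ssrnum ssrint intdiv zify.
From mathcomp Require Import boolp classical_sets functions.

(** Let N = n + 1. The group acts on the integers by affine permutations, s_c
exchanging x and x + 1 for x = c mod N. Induction on the length shows that
g s_c is shorter than g iff g(c) > g(c + 1): take a last letter of a reduced
word of g and use the commutation or braid relation. Hence w is a minimal
coset representative iff w(1) < ... < w(N).

For such a w <> 1, the window of w s_0 is obtained by replacing the minimum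
w(1) by w(N) - N and the maximum w(N) by w(1) + N, and sorting it gives the next
representative u; the sorting permutation v is increasing on 2, ..., n, and
such permutations are the products s_i ... s_1 s_{n-j+2} ... s_n, with
v(1) = i + 1 and v(N) = n - j + 2 - [i + j > n].

Conversely, for u a representative with window f, the product u v s_0 is again
a nontrivial representative iff f(v(N)) < f(1) + N and f(N) - N < f(v(1)). If u
itself ends with the segment C_{i,j}, then f(1) + N and f(N) - N are values of
the preceding window, and for v given by (k, l) the two inequalities become
(j < l, or j = l and k + l > n) and (i < k, or i = k and i + j > n), which is
the definition of an allowed pair. *)

Set Implicit Arguments.
Unset Strict Implicit.
Unset Printing Implicit Defensive.

(** * Length and parabolic subgroups in an arbitrary Coxeter group *)

Section CoxeterLength.
Local Open Scope group_scope.
Variables (I : choiceType) (m : I -> I -> nat).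
Implicit Types (g h : coxgroup m) (u v : seq I) (J : set I).

Lemma coxword_cat u v : coxword m (u ++ v) = coxword m u * coxword m v.
Proof. by rewrite !coxwordE big_cat. Qed.

Lemma coxgen_sq i : coxgen m i * coxgen m i = 1.
Proof. by rewrite -coxword_cat; apply/coxwordP/coxeq_sq. Qed.

Lemma coxgenV i : (coxgen m i)^-1 = coxgen m i.
Proof. by apply: mulg1_eq; apply: coxgen_sq. Qed.

Lemma mulg_coxgenK i g : g * coxgen m i * coxgen m i = g.
Proof. by rewrite -mulgA coxgen_sq mulg1. Qed.

Lemma mul_coxgenKg i g : coxgen m i * (coxgen m i * g) = g.
Proof. by rewrite mulgA coxgen_sq mul1g. Qed.

Lemma coxgen_braid i j : (coxgen m i * coxgen m j) ^+ m i j = 1.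
Proof.
rewrite -coxword_cat /=; transitivity (coxword m (flatten (nseq (m i j) [:: i; j]))).
  by elim: (m i j) => [|k IH] //; rewrite expgS IH -coxword_cat.
exact/coxwordP/coxeq_braid.
Qed.

Lemma coxgen_commute i j : m i j = 2 ->
  coxgen m i * coxgen m j = coxgen m j * coxgen m i.
Proof.
move=> mij; have := coxgen_braid i j; rewrite mij expg2 => /mulg1_eq <-.
by rewrite invgM !coxgenV.
Qed.

Lemma coxgen_braid3 i j : m i j = 3 ->
  coxgen m i * coxgen m j * coxgen m i = coxgen m j * coxgen m i * coxgen m j.
Proof.
move=> mij; have := coxgen_braid i j.
rewrite mij !expgS expg0 mulg1 !mulgA -!(mulgA (_ * _ * _)) => /mulg1_eq ijiV.
by rewrite -[RHS]mulgA -ijiV !invgM !coxgenV mulgA.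
Qed.

Lemma coxlen_leq u : coxlen (coxword m u) <= size u.
Proof.
rewrite /coxlen; case: ex_minnP => k _; apply; apply/asboolP.
by exists u; rewrite -?coxwordE.
Qed.

Lemma coxlen_reduced g : exists2 u, size u = coxlen g & coxword m u = g.
Proof.
rewrite /coxlen; case: ex_minnP => k /asboolP[u uk <-] _.
by exists u; rewrite ?coxwordE.
Qed.

Lemma coxlenM g h : coxlen (g * h) <= coxlen g + coxlen h.
Proof.
have [u <- <-] := coxlen_reduced g; have [v <- <-] := coxlen_reduced h.
by rewrite -coxword_cat -size_cat coxlen_leq.
Qed.

Lemma coxlen1 : coxlen (1 : coxgroup m) = 0.
Proof. by apply/eqP; rewrite -leqn0; apply: (coxlen_leq [::]). Qed.

Lemma coxlen_eq0 g : coxlen g = 0 -> g = 1.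
Proof. by move=> g0; have [u] := coxlen_reduced g; rewrite g0; case: u. Qed.

Lemma coxlen_coxgen i : coxlen (coxgen m i) <= 1.
Proof. exact: coxlen_leq [:: i]. Qed.

Lemma coxlen_mulgen g i : coxlen (g * coxgen m i) <= (coxlen g).+1.
Proof.
apply: leq_trans (coxlenM _ _) _.
by rewrite -(addn1 (coxlen g)) leq_add2l coxlen_coxgen.
Qed.

Lemma coxlenV g : coxlen g^-1 = coxlen g.
Proof.
suff le h : coxlen h^-1 <= coxlen h.
  by apply/eqP; rewrite eqn_leq le -{1}[g]invgK le.
have [u <- <-] := coxlen_reduced h; rewrite -size_rev.
suff -> : (coxword m u)^-1 = coxword m (rev u) by apply: coxlen_leq.
apply: mulg1_eq; rewrite -coxword_cat; apply/coxwordP.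
by rewrite -{1}[u]revK; apply: coxeq_revl.
Qed.

Lemma coxlen_last g : g != 1 ->
  exists j, coxlen (g * coxgen m j) < coxlen g.
Proof.
have [u <- <-] := coxlen_reduced g; case/lastP: u => [|u j].
  by rewrite eqxx.
move=> _; exists j.
by rewrite -cats1 coxword_cat mulg_coxgenK cats1 size_rcons ltnS coxlen_leq.
Qed.

Lemma parabolicP J g :
  parabolic m J g <-> exists2 u, (forall i, i \in u -> J i) & coxword m u = g.
Proof.
by split=> -[u Ju <-]; exists u; rewrite ?coxwordE.
Qed.

Lemma parabolic1 J : parabolic m J 1.
Proof. by exists [::]; rewrite ?big_nil. Qed.

Lemma parabolic_gen J i : J i -> parabolic m J (coxgen m i).
Proof.
by move=> Ji; exists [:: i]; rewrite ?big_seq1// => k; rewrite inE => /eqP->.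
Qed.

Lemma parabolicM J g h :
  parabolic m J g -> parabolic m J h -> parabolic m J (g * h).
Proof.
move=> [u Ju <-] [v Jv <-]; exists (u ++ v); rewrite ?big_cat// => i.
by rewrite mem_cat => /orP[/Ju|/Jv].
Qed.

Lemma parabolicV J g : parabolic m J g -> parabolic m J g^-1.
Proof.
move=> /parabolicP[u Ju <-]; apply/parabolicP; exists (rev u).
  by move=> i; rewrite mem_rev => /Ju.
symmetry; apply: mulg1_eq; rewrite -coxword_cat; apply/coxwordP.
by rewrite -{1}[u]revK; apply: coxeq_revl.
Qed.

End CoxeterLength.

(** * Reflections of the integers that commute with translation by [N] *)

Section Reflection.
Import GRing.Theory.
Local Open Scope ring_scope.
Implicit Types (c x y k r t : int).

Definition adj_swap t r : int :=
  if r == t then t + 1 else if r == t + 1 then t else r.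

Lemma adj_swapP t r :
  (r = t /\ adj_swap t r = t + 1) \/ (r = t + 1 /\ adj_swap t r = t) \/
  (r <> t /\ r <> t + 1 /\ adj_swap t r = r).
Proof. by rewrite /adj_swap; do ?case: eqP => ?; lia. Qed.

Lemma adj_swap_id t r : r <> t -> r <> t + 1 -> adj_swap t r = r.
Proof. by rewrite /adj_swap; do ?case: eqP. Qed.

Variable n : nat.

Let N : int := n.+1%:Z.

(** The index [c] is any integer, not a residue, so that [c] and [c + 1] are neighbours without
    wrapping around at [n]. *)
Definition refl c x : int :=
  if (N %| x - c)%Z then x + 1
  else if (N %| x - c - 1)%Z then x - 1 else x.

Lemma dvdz_small k r : - N < r < N -> (N %| k * N + r)%Z = (r == 0).
Proof.
move=> rN; rewrite rpredDl ?dvdz_mull ?dvdzz//.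
apply/idP/eqP => [/dvdzP[q]|->]; last exact: dvdz0.
move=> rE; have [q0|[q1|q1]] : q = 0 \/ q <= -1 \/ 1 <= q by lia.
- by rewrite rE q0 mul0r.
- rewrite /N in rN rE; nia.
- rewrite /N in rN rE; nia.
Qed.

Lemma adj_swap_block t r : 0 <= r < N -> 0 <= t < N - 1 ->
  0 <= adj_swap t r < N.
Proof. by rewrite /adj_swap; do ?case: ifP => ?; lia. Qed.

(* With a free block origin a, a pair of reflections can be computed inside one
   block: no wrap-around occurs when 0 <= t <= N - 2. *)
Lemma refl_block a k r t : 0 <= r < N -> 0 <= t < N - 1 ->
  refl (a + t) (a + k * N + r) = a + k * N + adj_swap t r.
Proof.
move=> rN tN; rewrite /refl /adj_swap.
rewrite (_ : _ - (a + t) = k * N + (r - t)); last by lia.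
rewrite (_ : _ - 1 = k * N + (r - t - 1)); last by lia.
rewrite !dvdz_small; [|lia|lia].
rewrite (_ : (r - t == 0) = (r == t)); last by lia.
rewrite (_ : (r - t - 1 == 0) = (r == t + 1)); last by lia.
by do ?case: ifP => ?; lia.
Qed.

Lemma refl_period c d x : (N %| c - d)%Z -> refl c x = refl d x.
Proof.
move=> cd; rewrite /refl.
rewrite (_ : x - d = x - c + (c - d)); last by lia.
rewrite (_ : x - c + (c - d) - 1 = x - c - 1 + (c - d)); last by lia.
by rewrite ![(N %| _ + (c - d))%Z]rpredDr.
Qed.

Lemma refl_translate c x : refl c (x + N) = refl c x + N.
Proof.
rewrite /refl.
rewrite (_ : x + N - c = x - c + N); last by lia.
rewrite (_ : x - c + N - 1 = x - c - 1 + N); last by lia.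
rewrite ![(N %| _ + N)%Z]rpredDr ?dvdzz//.
by case: ifP => _; [lia|case: ifP => _; lia].
Qed.

Lemma block_decomp a x : exists k r, 0 <= r < N /\ x = a + k * N + r.
Proof.
exists ((x - a) %/ N)%Z, ((x - a) %% N)%Z.
have := divz_eq (x - a) N.
have := ltz_pmod (x - a) (isT : 0 < N).
have := modz_ge0 (x - a) (isT : N != 0).
lia.
Qed.

(** The bounds on [t] put both exchanged pairs into the block starting at [c], where they are
    disjoint. *)
Lemma refl_commute c t x : 2 <= t < N - 1 ->
  refl c (refl (c + t) x) = refl (c + t) (refl c x).
Proof.
move=> tN; have [k [r [rN ->]]] := block_decomp c x.
have refl0 y : refl c y = refl (c + 0) y by rewrite addr0.
rewrite !refl0 !refl_block ?adj_swap_block //; try lia.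
have := adj_swapP 0 r; have := adj_swapP 0 (adj_swap t r).
by have := adj_swapP t r; have := adj_swapP t (adj_swap 0 r); lia.
Qed.

(** As [N >= 3], the points [c], [c + 1], [c + 2] lie in one block, and this is the braid relation
    of two adjacent transpositions. *)
Lemma refl_braid c x : 1 < N - 1 ->
  refl c (refl (c + 1) (refl c x)) = refl (c + 1) (refl c (refl (c + 1) x)).
Proof.
move=> N3; have [k [r [rN ->]]] := block_decomp c x.
have refl0 y : refl c y = refl (c + 0) y by rewrite addr0.
rewrite !refl0 !refl_block ?adj_swap_block //; try lia.
have := adj_swapP 0 r; have := adj_swapP 1 (adj_swap 0 r).
have := adj_swapP 0 (adj_swap 1 (adj_swap 0 r)).
have := adj_swapP 1 r; have := adj_swapP 0 (adj_swap 1 r).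
by have := adj_swapP 1 (adj_swap 0 (adj_swap 1 r)); lia.
Qed.

Lemma reflK c : (0 < n)%N -> involutive (refl c).
Proof.
move=> n_gt0 x; have [k [r [rN ->]]] := block_decomp c x.
have refl0 y : refl c y = refl (c + 0) y by rewrite addr0.
rewrite !refl0 !refl_block ?adj_swap_block //; try (rewrite /N; lia).
by have := adj_swapP 0 r; have := adj_swapP 0 (adj_swap 0 r); lia.
Qed.

End Reflection.

(** * The action on the integers, and descents as a test for length *)

Section AffinePermutations.
Import Order.TTheory GRing.Theory Num.Theory.
Local Open Scope ring_scope.
Variable n : nat.
Hypothesis n_gt0 : (0 < n)%N.
Implicit Types (i j : 'I_n.+1) (g h : affW n) (c x y : int).

Let N : int := n.+1%:Z.

(** Nodes that are not neighbours on the cycle are at least 2 apart both ways round, which is the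
    range required by [refl_commute]. *)
Lemma affA_mx_far i j : i != j ->
  ~~ ((i == j.+1 %[mod n.+1]) || (j == i.+1 %[mod n.+1])) ->
  exists t : int, 2 <= t < N - 1 /\ (j%:Z = i%:Z + t \/ i%:Z = j%:Z + t).
Proof.
rewrite negb_or -!val_eqE /=; case: i j => [a an] [b bn] /= ab /andP[].
rewrite !(modn_small an, modn_small bn) => abS baS.
exists (if (a < b)%N then b%:Z - a%:Z else a%:Z - b%:Z).
have [an1|an1] : (a.+1 < n.+1 \/ a.+1 = n.+1)%N by lia.
  have [bn1|bn1] : (b.+1 < n.+1 \/ b.+1 = n.+1)%N by lia.
    rewrite !modn_small // in abS baS; rewrite /N; case: ltnP => ?; lia.
  rewrite bn1 modnn modn_small // in abS baS; rewrite /N; case: ltnP => ?; lia.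
have bn1 : (b.+1 < n.+1)%N by lia.
rewrite an1 modnn modn_small // in abS baS; rewrite /N; case: ltnP => ?; lia.
Qed.

Lemma mod_succ_dvdz i j : i == j.+1 %[mod n.+1] -> (N %| i%:Z - (j%:Z + 1))%Z.
Proof.
by move=> ij; rewrite (_ : j%:Z + 1 = j.+1%:Z) -?eqz_mod_dvd ?eqz_nat ?modz_nat //; lia.
Qed.

Lemma affA_mxP i j : i != j ->
  (affA_mx i j = 2 /\
    exists t : int, 2 <= t < N - 1 /\ (j%:Z = i%:Z + t \/ i%:Z = j%:Z + t)) \/
  (affA_mx i j = (if n == 1 then 0 else 3)%N /\
    ((N %| i%:Z - (j%:Z + 1))%Z \/ (N %| j%:Z - (i%:Z + 1))%Z)).
Proof.
move=> ij; rewrite /affA_mx (negbTE ij); case: ifPn => adj.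
  by right; split=> //; case/orP: adj => /mod_succ_dvdz; [left|right].
by left; split=> //; apply: affA_mx_far.
Qed.

Definition act (u : seq 'I_n.+1) x : int :=
  foldr (fun i : 'I_n.+1 => refl n i%:Z) x u.

Lemma act_cat u v x : act (u ++ v) x = act u (act v x).
Proof. by rewrite /act foldr_cat. Qed.

(** The reflections satisfy the defining relations, so the action of words passes to the group. *)
Lemma coxeq_act u v : coxeq (@affA_mx n) u v -> act u =1 act v.
Proof.
elim=> {u v} [u x //|u v _ IH x|u v w _ uv _ vw x|u u' v v' _ Hu _ Hv x|i x|i j x].
- by rewrite IH.
- by rewrite uv.
- by rewrite !act_cat Hv Hu.
- exact: (reflK _ n_gt0).
have [<-|ij] := eqVneq i j; first by rewrite /affA_mx eqxx; apply: (reflK _ n_gt0).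
case: (affA_mxP ij) => [[-> [t [tN]]]|[-> adj]].
  rewrite /act /=; case=> ->; first by rewrite -refl_commute// !(reflK _ n_gt0).
  by rewrite refl_commute// !(reflK _ n_gt0).
(* For [n = 1] the exponent 0 makes the relation empty; otherwise [N >= 3] and the braid relation is
   available. *)
case: ifP => // n1; rewrite /act /=.
have N3 : 1 < N - 1 by rewrite /N; lia.
case: adj => /refl_period E; rewrite !E; last by rewrite refl_braid// !(reflK _ n_gt0).
by rewrite -refl_braid// !(reflK _ n_gt0).
Qed.

Definition perm_of g : int -> int := act (repr g).

Lemma perm_of_word u : perm_of (coxword _ u) =1 act u.
Proof. exact/coxeq_act/repr_coxword. Qed.

Lemma perm_ofM g h x : perm_of (g * h)%g x = perm_of g (perm_of h x).
Proof.
have [u <-] := coxword_surj g; have [v <-] := coxword_surj h.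
by rewrite -coxword_cat !perm_of_word act_cat.
Qed.

Lemma perm_of1 x : perm_of 1%g x = x.
Proof. exact: (perm_of_word [::]). Qed.

Lemma perm_ofgen i x : perm_of (coxgen _ i) x = refl n i%:Z x.
Proof. exact: (perm_of_word [:: i]). Qed.

Lemma perm_ofVK g : cancel (perm_of g) (perm_of g^-1%g).
Proof. by move=> x; rewrite -perm_ofM mulVg perm_of1. Qed.

Lemma perm_ofKV g : cancel (perm_of g^-1%g) (perm_of g).
Proof. by move=> x; rewrite -perm_ofM mulgV perm_of1. Qed.

Lemma perm_of_inj g : injective (perm_of g).
Proof. exact: can_inj (perm_ofVK g). Qed.

Lemma perm_of_translate g x : perm_of g (x + N) = perm_of g x + N.
Proof.
have [u <-] := coxword_surj g; rewrite !perm_of_word.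
by elim: u => //= i u ->; rewrite refl_translate.
Qed.

Lemma perm_of_translate_mul g x k : perm_of g (x + k * N) = perm_of g x + k * N.
Proof.
have pos (l : nat) y : perm_of g (y + l%:Z * N) = perm_of g y + l%:Z * N.
  elim: l => [|l IH]; first by rewrite mul0r !addr0.
  rewrite (_ : l.+1%:Z * N = l%:Z * N + N); last by lia.
  by rewrite !addrA perm_of_translate IH.
case: k => l; first exact: pos.
by rewrite NegzE mulNr; have := pos l.+1 (x - l.+1%:Z * N); rewrite subrK => ->; rewrite addrK.
Qed.

Definition descent g c := perm_of g (c + 1) < perm_of g c.

Lemma descent_period g c d : (N %| c - d)%Z -> descent g c = descent g d.
Proof.
move=> /dvdzP[k] /eqP; rewrite subr_eq => /eqP ->.
rewrite /descent -addrA !(addrC (k * _)) !perm_of_translate_mul.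
by rewrite ltrD2r.
Qed.

Lemma refl_at c : refl n c c = c + 1.
Proof. by rewrite /refl subrr dvdz0. Qed.

Lemma refl_succ c : refl n c (c + 1) = c.
Proof. by rewrite -{1}refl_at (reflK _ n_gt0). Qed.

Lemma descent_gen g i :
  descent (g * coxgen _ i)%g i%:Z = ~~ descent g i%:Z.
Proof.
rewrite /descent !perm_ofM !perm_ofgen refl_at refl_succ.
have : perm_of g i%:Z <> perm_of g (i%:Z + 1) by move/perm_of_inj; lia.
lia.
Qed.

Lemma refl_near c t r : 0 <= r < N -> 0 <= t < N - 1 ->
  refl n (c + t) (c + r) = c + adj_swap t r.
Proof. by have := @refl_block n c 0 r t; rewrite mul0r addr0. Qed.

Lemma refl_near0 c r : 0 <= r < N -> refl n c (c + r) = c + adj_swap 0 r.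
Proof.
by move=> rN; rewrite -[X in refl n X]addr0 refl_near//; rewrite /N; lia.
Qed.

Lemma refl_at_near c t : 0 <= t < N - 1 -> refl n (c + t) c = c + adj_swap t 0.
Proof. by move=> tN; rewrite -[X in refl n _ X]addr0 refl_near//; lia. Qed.

Lemma refl_triple c : 1 < N - 1 ->
  [/\ refl n c (c + 2) = c + 2, refl n (c + 1) c = c,
      refl n (c + 1) (c + 1) = c + 2 & refl n (c + 1) (c + 2) = c + 1].
Proof.
move=> N3; have sw02 := adj_swapP 0 2.
have sw10 := adj_swapP 1 0; have sw11 := adj_swapP 1 1.
have sw12 := adj_swapP 1 2.
by split; [rewrite refl_near0|rewrite refl_at_near|rewrite refl_near|rewrite refl_near]; lia.
Qed.

Lemma refl_far c t : 2 <= t < N - 1 ->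
  [/\ refl n c (c + t) = c + t, refl n c (c + t + 1) = c + t + 1,
      refl n (c + t) c = c & refl n (c + t) (c + 1) = c + 1].
Proof.
move=> tN; rewrite -addrA; split.
- by rewrite refl_near0 ?adj_swap_id; lia.
- by rewrite refl_near0 ?adj_swap_id; lia.
- by rewrite refl_at_near ?adj_swap_id; lia.
- by rewrite refl_near ?adj_swap_id; lia.
Qed.

(** Let [h = g s_j] with [s_j] the last letter of a reduced word of [g]. If [s_i] and [s_j] commute,
    [h] already has the descent [i] and [g s_i = (h s_i) s_j]. If they braid, [h s_i s_j] is two
    shorter than [h] and [g s_i = (h s_i s_j) s_i s_j]. Either way the length of [g s_i] is at most
    that of [h]. *)
Lemma descent_coxlen g i : descent g i%:Z ->
  (coxlen (g * coxgen _ i)%g < coxlen g)%N.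
Proof.
have [k] := ubnP (coxlen g); elim: k g i => // k IH g i gk di.
have g1 : g != 1%g.
  by apply: contraTneq di => ->; rewrite /descent !perm_of1; lia.
have [j hg] := coxlen_last g1.
set h := (g * _)%g in hg; have gE : g = (h * coxgen _ j)%g by rewrite mulg_coxgenK.
have hk : (coxlen h < k)%N by lia.
(* Otherwise [h] would have the descent [j], and induction would make [g = h s_j] shorter than
   [h]. *)
have dj : descent g j%:Z.
  by apply/negPn/negP => dj; have := IH h j hk; rewrite descent_gen -gE => /(_ dj); lia.
have [<-//|ij] := eqVneq j i.
case: (affA_mxP ij) => [[mji [t [tN tE]]]|[mji adj]].
  have dhi : descent h i%:Z.
    have far : refl n j%:Z i%:Z = i%:Z /\ refl n j%:Z (i%:Z + 1) = i%:Z + 1.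
      by case: tE => ->; [case: (refl_far j%:Z tN)|case: (refl_far i%:Z tN)].
    by move: di; rewrite /descent !perm_ofM !perm_ofgen far.1 far.2.
  have -> : (g * coxgen _ i = h * coxgen _ i * coxgen _ j)%g.
    by rewrite gE -!mulgA (coxgen_commute mji).
  apply: leq_ltn_trans (coxlen_mulgen _ _) _.
  exact: leq_ltn_trans (IH h i hk dhi) hg.
case: eqP mji => [n1 _|n1 mji].
  (* In rank one the two descents would give f 0 > f 1 > f 2 = f 0 + 2. *)
  have : descent g 0 /\ descent g 1.
    have [] : (i = 0 :> nat /\ j = 1 :> nat) \/ (i = 1 :> nat /\ j = 0 :> nat).
    - by move: ij; rewrite -val_eqE /=; have := ltn_ord i; have := ltn_ord j; lia.
    - by move=> [i0 j0]; move: di dj; rewrite i0 j0.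
    - by move=> [i0 j0]; move: di dj; rewrite i0 j0.
  rewrite /descent; have := perm_of_translate g 0.
  rewrite (_ : 0 + N = 1 + 1); last by rewrite /N; lia.
  by rewrite !add0r => ->; lia.
have N3 : 1 < N - 1 by rewrite /N; lia.
have add2 c : c + 1 + 1 = c + 2 by lia.
(* [g] has descents at two neighbouring places, so it decreases along three consecutive integers;
   undoing [s_j] and then [s_i] leaves the required descents. *)
have [dhi dh2] : descent h i%:Z /\ descent (h * coxgen _ i)%g j%:Z.
  case: adj => [ji|ij1].
    have [r1 r2 r3 r4] := refl_triple i%:Z N3.
    rewrite (descent_period _ ji); rewrite (descent_period _ ji) in dj.
    move: di dj; rewrite /descent !perm_ofM !perm_ofgen !(refl_period _ ji) add2.
    rewrite r1 refl_succ r2 r3 r4; lia.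
  have [r1 r2 r3 r4] := refl_triple j%:Z N3.
  rewrite (descent_period h ij1); rewrite (descent_period g ij1) in di.
  move: di dj; rewrite /descent !perm_ofM !perm_ofgen !(refl_period _ ij1) add2.
  rewrite r1 r2 r3 refl_at refl_succ r1; lia.
have lenhi := IH _ _ hk dhi.
have lenhij := IH _ _ (ltn_trans lenhi hk) dh2.
set h3 := (_ * coxgen _ j)%g in lenhij.
suff -> : (g * coxgen _ i = h3 * coxgen _ i * coxgen _ j)%g.
  apply: leq_ltn_trans (coxlen_mulgen _ _) _.
  apply: leq_ltn_trans (_ : (coxlen h3).+2 < _)%N.
    by rewrite ltnS; apply: coxlen_mulgen.
  by apply: leq_ltn_trans hg; apply: leq_ltn_trans lenhi.
have ijij : (coxgen (@affA_mx n) i * coxgen _ j * coxgen _ i * coxgen _ j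
             = coxgen _ j * coxgen _ i)%g.
  by rewrite -(coxgen_braid3 mji) mulg_coxgenK.
by rewrite /h3 gE -mulgA -ijij !mulgA.
Qed.
End AffinePermutations.

(** * Minimal coset representatives as permutations with increasing window *)

Section GrassmannianElements.
Import Order.TTheory GRing.Theory Num.Theory.
Local Open Scope ring_scope.

Lemma increasing_range (f : int -> int) (a b : int) :
  (forall x : int, a <= x -> x < b -> f x < f (x + 1)) ->
  forall x y : int, a <= x -> x < y -> y <= b -> f x < f y.
Proof.
move=> fS x y ax xy yb.
have [d] : exists d : nat, y = x + d.+1%:Z.
  by exists (absz (y - x - 1)%R); lia.
elim: d y xy yb => [|d IH] y xy yb yE; first by rewrite yE; apply: fS; lia.
have := IH (y - 1); have := fS (y - 1); rewrite subrK; lia.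
Qed.

Variable n : nat.
Hypothesis n_gt0 : (0 < n)%N.
Implicit Types (i j : 'I_n.+1) (g h u v w : affW n) (c x y : int).

Let N : int := n.+1%:Z.
Let perm_ofM := perm_ofM n_gt0.
Let perm_of1 := perm_of1 n_gt0.

Lemma len_descent g i : descent g i%:Z ->
  len g = (len (g * coxgen _ i)%g).+1.
Proof.
move=> di; apply/eqP; rewrite eqn_leq (descent_coxlen n_gt0 di) andbT.
by rewrite /len -{1}(mulg_coxgenK i g) coxlen_mulgen.
Qed.

Lemma len_ascent g i : ~~ descent g i%:Z ->
  len (g * coxgen _ i)%g = (len g).+1.
Proof.
by rewrite -(descent_gen n_gt0) => /len_descent ->; rewrite mulg_coxgenK.
Qed.

Lemma descentP g i : descent g i%:Z = (len (g * coxgen _ i)%g < len g)%N.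
Proof.
by case: (boolP (descent g i%:Z)) => [/len_descent|/len_ascent] ->; lia.
Qed.

Lemma exists_descent g : g != 1%g -> exists i, descent g i%:Z.
Proof. by move=> /coxlen_last[i gi]; exists i; rewrite descentP. Qed.

(** Inversion preserves length and turns left multiplication into right multiplication. *)
Lemma lenMl g i : ~~ descent g^-1%g i%:Z -> len (coxgen _ i * g)%g = (len g).+1.
Proof.
move=> /len_ascent; rewrite /len coxlenV => <-.
by rewrite -[in LHS]coxlenV invgM coxgenV.
Qed.

Lemma perm_of_s k x : (k <= n)%N -> perm_of (s_ n k) x = refl n k%:Z x.
Proof. by move=> kn; rewrite perm_ofgen// inordK. Qed.

Definition in_block x := 1 <= x <= N.

Lemma refl_fin (k : nat) x : (1 <= k <= n)%N -> in_block x ->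
  refl n k%:Z x = adj_swap k%:Z x.
Proof.
rewrite /in_block => kn xN.
rewrite (_ : k%:Z = 1 + (k%:Z - 1)); last by lia.
rewrite {1}(_ : x = 1 + (x - 1)); last by lia.
rewrite refl_near; [|lia|lia].
by rewrite /adj_swap; do ?case: eqP => ?; lia.
Qed.

Lemma refl_fin_block (k : nat) x : (1 <= k <= n)%N -> in_block x ->
  in_block (refl n k%:Z x).
Proof.
move=> kn xN; rewrite refl_fin//; move: xN; rewrite /in_block.
by have := adj_swapP k%:Z x; rewrite /N; lia.
Qed.

Lemma refl0_1 : refl n 0 1 = 0.
Proof. by have := refl_succ n_gt0 0. Qed.

Lemma refl0_N : refl n 0 N = N + 1.
Proof.
by rewrite -[N]add0r refl_translate refl_at// addrAC.
Qed.

Lemma refl0_mid x : 2 <= x <= n%:Z -> refl n 0 x = x.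
Proof.
move=> xn; rewrite -{1}[x]add0r refl_near0 ?adj_swap_id; rewrite ?add0r; lia.
Qed.

Lemma finW_block v x : finW v -> in_block x -> in_block (perm_of v x).
Proof.
move=> /parabolicP[u Su <-]; rewrite (perm_of_word n_gt0).
elim: u Su => //= i u IH Su xN; apply: refl_fin_block; last first.
  by apply: IH => // j uj; apply: Su; rewrite inE uj orbT.
have := Su i (mem_head _ _); rewrite /finS /= -val_eqE /=.
by have := ltn_ord i; lia.
Qed.

Lemma finW_s k : (1 <= k <= n)%N -> finW (s_ n k).
Proof.
move=> kn; apply: parabolic_gen; rewrite /finS /= -val_eqE /= inordK; lia.
Qed.

(** Since [v] preserves the window, [v(0) = v(N) - N <= 0 < v(1)], so 0 is not a descent. *)
Lemma finW_descent v i : finW v -> descent v i%:Z -> i != ord0.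
Proof.
move=> Wv; apply: contraTneq => ->; rewrite /descent /= -leNgt.
have b1 : in_block (perm_of v 1) by apply: finW_block; rewrite // /in_block /N.
have bN : in_block (perm_of v N) by apply: finW_block; rewrite // /in_block /N; lia.
have := perm_of_translate n_gt0 v 0; rewrite !add0r => E.
by change (perm_of v 0 <= perm_of v 1); move: b1 bN; rewrite E /in_block; lia.
Qed.

Definition block_incr g := forall x y, 1 <= x -> x < y -> y <= N ->
  perm_of g x < perm_of g y.

Lemma block_incrP g : (forall i, i != ord0 -> ~~ descent g i%:Z) <-> block_incr g.
Proof.
split=> [gS|gI i i0].
  apply: increasing_range => x x1 xN.
  have xn : (absz x < n.+1)%N by rewrite /N in xN; lia.
  have := gS (Ordinal xn); rewrite -val_eqE /= /descent.
  have := @perm_of_inj n n_gt0 g x (x + 1).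
  by rewrite (_ : (absz x)%:Z = x); lia.
rewrite /descent -leNgt; apply/ltW/gI; last first.
- by have := ltn_ord i; rewrite /N; lia.
- by rewrite ltrDl.
by move: i0; rewrite -val_eqE /=; lia.
Qed.

(** Strip a descent [i] from [v], leaving [v']. Then [v'(i) < v'(i + 1)] inside the window, where
    [u] keeps the order; so [i] is an ascent of [u v'] and restoring [s_i] adds one to both
    sides. *)
Lemma len_parabolic u v : block_incr u -> finW v -> len (u * v)%g = (len u + len v)%N.
Proof.
move=> uI; have [k] := ubnP (len v); elim: k v => // k IH v vk Wv.
have [->|/exists_descent[i di]] := eqVneq v 1%g.
  by rewrite mulg1 /len coxlen1 addn0.
have i0 := finW_descent Wv di; have vE := len_descent di.
set v' := (v * _)%g in vE; have v'E : v = (v' * coxgen _ i)%g by rewrite mulg_coxgenK.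
have Wv' : finW v' by apply: parabolicM => //; apply: parabolic_gen.
rewrite {1}v'E mulgA len_ascent ?IH// ?vE ?addnS//; first by rewrite -vE.
have : ~~ descent v' i%:Z by rewrite (descent_gen n_gt0) negbK.
rewrite /descent !(perm_ofM u) -!leNgt.
have ne : perm_of v' i%:Z <> perm_of v' (i%:Z + 1) by move/(perm_of_inj n_gt0); lia.
have [iN iN1] : in_block i%:Z /\ in_block (i%:Z + 1).
  by move: i0 (ltn_ord i); rewrite -val_eqE /in_block /N /=; lia.
have /andP[b1 _] := finW_block Wv' iN; have /andP[_ b2] := finW_block Wv' iN1.
by move=> le; apply/ltW/uI => //; rewrite lt_neqAle le andbT; apply/eqP.
Qed.

(** Minimality tested against single generators excludes finite descents; conversely, additivity of
    length gives minimality against all of the finite group. *)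
Lemma affWSP w : affWS w <-> block_incr w.
Proof.
split=> [wS|wI v Wv]; last first.
  by have := len_parabolic wI Wv; rewrite /len => ->; apply: leq_addr.
apply/block_incrP => i i0; rewrite descentP -leqNgt.
by apply: wS; apply: parabolic_gen.
Qed.

(** Finite descents are stripped from the right until none is left; the length drops each time. *)
Lemma affWS_finW_decomp g : exists u v, [/\ affWS u, finW v & g = (u * v)%g].
Proof.
have [k] := ubnP (len g); elim: k g => // k IH g gk.
have [gS|] := pselect (affWS g).
  by exists g, 1%g; split; rewrite ?mulg1//; apply: parabolic1.
move=> gS; have [i [i0 di]] : exists i, i != ord0 /\ descent g i%:Z.
  apply: contrapT => nodesc; apply/gS/affWSP/block_incrP => i i0.
  by apply/negP => di; apply: nodesc; exists i.
have [|u [v [uS Wv E]]] := IH (g * coxgen _ i)%g.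
  by rewrite -ltnS -(len_descent di).
exists u, (v * coxgen _ i)%g; split=> //.
  by apply: parabolicM => //; apply: parabolic_gen.
by rewrite mulgA -E mulg_coxgenK.
Qed.

(** With [x = v v'^-1], additivity applied to [u' = u x] and to [u = u' x^-1] forces [x] to have
    length 0. *)
Lemma affWS_finW_uniq u v u' v' : affWS u -> affWS u' -> finW v -> finW v' ->
  (u * v = u' * v')%g -> u = u' /\ v = v'.
Proof.
move=> /affWSP uI /affWSP uI' Wv Wv' E.
have u'E : u' = (u * (v * v'^-1))%g by rewrite mulgA E mulgK.
have Wx : finW (v * v'^-1)%g by apply: parabolicM => //; apply: parabolicV.
have l1 := len_parabolic uI Wx.
have l2 : len u = (len u' + len (v * v'^-1)^-1)%N%g.
  by rewrite -len_parabolic//; [rewrite u'E mulgK|apply: parabolicV].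
have x1 : (v * v'^-1 = 1)%g.
  by apply: coxlen_eq0; rewrite -u'E in l1; rewrite /len in l1 l2 *; lia.
move: u'E; rewrite x1 mulg1 => ->; split=> //; exact: divg1_eq.
Qed.

Lemma affWS_descent w i : affWS w -> descent w i%:Z -> i = ord0.
Proof.
move=> /affWSP/block_incrP wI di; apply/eqP.
by apply: contraTT di => /wI.
Qed.

Lemma affWS_descent0 w : affWS w -> w != 1%g -> descent w 0.
Proof.
by move=> wS /exists_descent[i di]; have := di; rewrite (affWS_descent wS di).
Qed.

End GrassmannianElements.

(** * The finite parts of segments, and multiplication by a segment *)

Section Segments.
Import Order.TTheory GRing.Theory Num.Theory.
Local Open Scope ring_scope.
Variable n : nat.
Hypothesis n_gt0 : (0 < n)%N.
Implicit Types (g h u v w : affW n) (c x y : int) (i j k l : nat).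

Let N : int := n.+1%:Z.
Let perm_ofM := perm_ofM n_gt0.
Let perm_of1 := perm_of1 n_gt0.

Definition down_run i : affW n := (\prod_(k <- rev (iota 1 i)) s_ n k)%g.
(** There are [j - 1] factors: the final [s_0] of the segment accounts for the missing one. *)
Definition up_run j : affW n := (\prod_(n - j + 2 <= k < n.+1) s_ n k)%g.

Lemma segmentE i j : segment n i j = (down_run i * up_run j * s_ n 0)%g.
Proof. by []. Qed.

Lemma down_run0 : down_run 0 = 1%g.
Proof. by rewrite /down_run big_nil. Qed.

Lemma down_runS i : down_run i.+1 = (s_ n i.+1 * down_run i)%g.
Proof.
by rewrite /down_run -{1}(addn1 i) iotaD rev_cat big_cat /= big_seq1 add1n.
Qed.

Lemma up_run1 : up_run 1 = 1%g.
Proof. by rewrite /up_run big_geq //; lia. Qed.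

Lemma up_runS j : (1 <= j < n)%N -> up_run j.+1 = (s_ n (n - j + 1) * up_run j)%g.
Proof.
move=> jn; rewrite /up_run big_ltn; last by lia.
by congr (s_ n _ * \prod_(_ <= k < _) s_ n k)%g; lia.
Qed.

Lemma finW_down_run i : (i <= n)%N -> finW (down_run i).
Proof.
elim: i => [|i IH] i_n; first by rewrite down_run0; apply: parabolic1.
by rewrite down_runS; apply: parabolicM; [apply: finW_s; lia|apply: IH; lia].
Qed.

Lemma finW_up_run j : (1 <= j <= n)%N -> finW (up_run j).
Proof.
case: j => // j; elim: j => [|j IH] jn; first by rewrite up_run1; apply: parabolic1.
by rewrite up_runS; [apply: parabolicM; [apply: finW_s; lia|apply: IH; lia]|lia].
Qed.

Lemma perm_down_run i x : (i <= n)%N -> in_block n x ->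
  (x = 1 /\ perm_of (down_run i) x = i%:Z + 1) \/
  (1 < x <= i%:Z + 1 /\ perm_of (down_run i) x = x - 1) \/
  (1 < x /\ i%:Z + 1 < x /\ perm_of (down_run i) x = x).
Proof.
elim: i => [|i IH] i_n xN.
  by rewrite down_run0 perm_of1; move: xN; rewrite /in_block; lia.
have i_n' : (i <= n)%N by lia.
have b : in_block n (perm_of (down_run i) x).
  by apply: finW_block => //; apply: finW_down_run.
rewrite down_runS perm_ofM perm_of_s// refl_fin//.
by move: (IH i_n' xN) (adj_swapP i.+1%:Z (perm_of (down_run i) x)); lia.
Qed.

Lemma perm_up_run j x : (1 <= j <= n)%N -> in_block n x ->
  (x = N /\ perm_of (up_run j) x = n%:Z - j%:Z + 2) \/
  (x < N /\ x < n%:Z - j%:Z + 2 /\ perm_of (up_run j) x = x) \/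
  (x < N /\ n%:Z - j%:Z + 2 <= x /\ perm_of (up_run j) x = x + 1).
Proof.
case: j => // j; elim: j => [|j IH] jn xN.
  by rewrite up_run1 perm_of1; move: xN; rewrite /in_block /N; lia.
have jn' : (1 <= j.+1 <= n)%N by lia.
have b : in_block n (perm_of (up_run j.+1) x).
  by apply: finW_block => //; apply: finW_up_run.
rewrite up_runS ?perm_ofM ?perm_of_s ?refl_fin//; try lia.
by move: (IH jn' xN) (adj_swapP (n - j.+1 + 1)%N%:Z (perm_of (up_run j.+1) x)); lia.
Qed.

Lemma block1 : in_block n 1. Proof. by rewrite /in_block; lia. Qed.
Lemma blockN : in_block n N. Proof. by rewrite /in_block /N; lia. Qed.

Lemma perm_run1 i j : (i <= n)%N -> (1 <= j <= n)%N ->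
  perm_of (down_run i * up_run j)%g 1 = i%:Z + 1.
Proof.
move=> i_n jn; rewrite perm_ofM.
have -> : perm_of (up_run j) 1 = 1.
  by have := perm_up_run jn block1; rewrite /N; lia.
by have := perm_down_run i_n block1; lia.
Qed.

Lemma finW_run i j : (i <= n)%N -> (1 <= j <= n)%N ->
  finW (down_run i * up_run j)%g.
Proof.
by move=> i_n jn; apply: parabolicM; [apply: finW_down_run|apply: finW_up_run].
Qed.

(** Left multiplication by [s_k] lengthens when the value [k] stands to the left of [k + 1]. Here
    the position of [k] is known, in the next lemma that of [k + 1]. *)
Lemma len_left_ascent k g x : (k <= n)%N -> perm_of g x = k%:Z ->
  x < perm_of g^-1%g (k%:Z + 1) -> len (s_ n k * g)%g = (len g).+1.
Proof.
move=> kn gx lt; apply: lenMl => //; rewrite inordK// /descent -leNgt.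
by rewrite -{1}gx perm_ofVK// ltW.
Qed.

Lemma len_left_ascent_succ k g x : (k <= n)%N -> perm_of g x = k%:Z + 1 ->
  perm_of g^-1%g k%:Z < x -> len (s_ n k * g)%g = (len g).+1.
Proof.
move=> kn gx lt; apply: lenMl => //; rewrite inordK// /descent -leNgt.
by rewrite -gx perm_ofVK// ltW.
Qed.

Lemma finW_block_neq v x y : finW v -> in_block n x -> x <> perm_of v y ->
  in_block n (perm_of v^-1%g x) /\ perm_of v^-1%g x <> y.
Proof.
move=> Wv xN ne; split; first by apply: finW_block => //; apply: parabolicV.
by move=> E; apply: ne; rewrite -E perm_ofKV.
Qed.

(** Before each new left factor [s_k], the value [k + 1] stands at the last place [N], so [k] stands
    to its left. *)
Lemma len_up_run j : (1 <= j <= n)%N -> (len (up_run j)).+1 = j.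
Proof.
case: j => // j; elim: j => [|j IH] jn; first by rewrite up_run1 /len coxlen1.
have jn' : (1 <= j.+1 <= n)%N by lia.
have EN : perm_of (up_run j.+1) N = (n - j.+1 + 1)%N%:Z + 1.
  by have := perm_up_run jn' blockN; lia.
rewrite up_runS; last by lia.
rewrite (len_left_ascent_succ (x := N)) ?IH//; first by lia.
have [||] := @finW_block_neq (up_run j.+1) (n - j.+1 + 1)%N%:Z N (finW_up_run jn').
- by rewrite /in_block; lia.
- by rewrite EN; lia.
- by rewrite /in_block /N; lia.
Qed.

(** Before each new left factor [s_k], the value [k] stands at the first place 1, so [k + 1] stands
    to its right. The successor counts the final [s_0]. *)
Lemma len_run i j : (i <= n)%N -> (1 <= j <= n)%N ->
  (len (down_run i * up_run j)%g).+1 = (i + j)%N.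
Proof.
move=> + jn; elim: i => [|i IH] i_n; first by rewrite down_run0 mul1g len_up_run.
have i_n' : (i <= n)%N by lia.
have E1 := perm_run1 i_n' jn.
rewrite down_runS -mulgA (len_left_ascent (x := 1)) ?IH ?E1//; first by lia.
have [|||] := @finW_block_neq (down_run i * up_run j)%g (i.+1%:Z + 1) 1.
- exact: finW_run.
- by rewrite /in_block; lia.
- by rewrite E1; lia.
- by move: (perm_of _ (_ + 1)) => p; rewrite /in_block; lia.
Qed.

Lemma run_inj i j k l : (i <= n)%N -> (1 <= j <= n)%N ->
  (k <= n)%N -> (1 <= l <= n)%N ->
  (down_run i * up_run j = down_run k * up_run l)%g -> i = k /\ j = l.
Proof.
move=> i_n jn kn ln E.
have ik : i = k by have := perm_run1 i_n jn; rewrite E perm_run1//; lia.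
move: E; rewrite ik => /mulgI E; split=> //.
by have := perm_up_run jn blockN; have := perm_up_run ln blockN; rewrite E; lia.
Qed.

(** Within the finite group these are the minimal representatives modulo the subgroup generated by
    [s_2, ..., s_{n-1}]. *)
Definition mid_incr g := forall x y, 2 <= x -> x < y -> y <= n%:Z ->
  perm_of g x < perm_of g y.

Lemma mid_incr_run i j : (i <= n)%N -> (1 <= j <= n)%N ->
  mid_incr (down_run i * up_run j)%g.
Proof.
move=> i_n jn; apply: increasing_range => x x2 xn; rewrite !perm_ofM.
have bx : in_block n x by rewrite /in_block; lia.
have by1 : in_block n (x + 1) by rewrite /in_block; lia.
have := perm_down_run i_n (finW_block n_gt0 (finW_up_run jn) bx).
have := perm_down_run i_n (finW_block n_gt0 (finW_up_run jn) by1).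
by have := perm_up_run jn bx; have := perm_up_run jn by1; rewrite /N; lia.
Qed.

(** One of the exchanged values [k], [k + 1] stands at an end of the window, so no two values at
    interior places are exchanged. *)
Lemma mid_incr_mulsl k v z : (1 <= k <= n)%N -> finW v -> mid_incr v ->
  z = 1 \/ z = N -> perm_of v z = k%:Z \/ perm_of v z = k%:Z + 1 ->
  mid_incr (s_ n k * v)%g.
Proof.
move=> kn Wv vI zE vz x y x2 xy yn; rewrite !perm_ofM !perm_of_s//; try lia.
have bx : in_block n x by rewrite /in_block; lia.
have by_ : in_block n y by rewrite /in_block; lia.
rewrite !refl_fin//; try exact: finW_block.
have lt := vI x y x2 xy yn.
have nx : perm_of v x <> perm_of v z by move/(perm_of_inj n_gt0); rewrite /N in zE; lia.
have ny : perm_of v y <> perm_of v z by move/(perm_of_inj n_gt0); rewrite /N in zE; lia.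
have := adj_swapP k%:Z (perm_of v x); have := adj_swapP k%:Z (perm_of v y).
by rewrite -/(perm_of v); lia.
Qed.

(** Fixed ends and an increasing interior leave no room for a descent. *)
Lemma finW_fix_eq1 v : finW v -> mid_incr v -> perm_of v 1 = 1 ->
  perm_of v N = N -> v = 1%g.
Proof.
move=> Wv vI v1 vN; apply/eqP/negPn/negP => /(exists_descent n_gt0)[i di].
have i0 := finW_descent n_gt0 Wv di; move: di; rewrite /descent; apply/negP.
rewrite -leNgt; have iN := ltn_ord i.
have i_gt0 : (0 < i)%N by move: i0; rewrite -val_eqE /=; lia.
have bi : in_block n i%:Z by rewrite /in_block; lia.
have bi1 : in_block n (i%:Z + 1) by rewrite /in_block; lia.
have /andP[_ b2] := finW_block n_gt0 Wv bi.
have /andP[b1 _] := finW_block n_gt0 Wv bi1.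
have [i1|i_gt1] : nat_of_ord i = 1%N \/ (1 < i)%N by lia.
  by apply: le_trans b1; rewrite i1 v1.
have [i_n|i_ltn] : i%:Z + 1 = N \/ (i < n)%N by rewrite /N; lia.
  by rewrite i_n vN.
by apply/ltW/vI; lia.
Qed.

(** Left multiplication by [s_i, ..., s_1] in turn brings the value at 1 down to 1 and keeps the
    interior increasing. *)
Lemma finW_down_factor i v : (i <= n)%N -> finW v -> mid_incr v ->
  perm_of v 1 = i%:Z + 1 ->
  exists2 v', v = (down_run i * v')%g &
    [/\ finW v', mid_incr v' & perm_of v' 1 = 1].
Proof.
elim: i v => [|i IH] v i_n Wv vI v1.
  by exists v; rewrite ?down_run0 ?mul1g.
have kn : (1 <= i.+1 <= n)%N by lia.
have [||||v' E v'P] := IH (s_ n i.+1 * v)%g.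
- by lia.
- by apply: parabolicM => //; apply: finW_s.
- apply: (mid_incr_mulsl (z := 1)) => //; first by left.
  by right.
- rewrite perm_ofM perm_of_s// v1 refl_succ//; lia.
exists v' => //; rewrite down_runS -mulgA -E.
by rewrite mul_coxgenKg.
Qed.

(** Symmetrically, the value at [N] is raised step by step to [N]. The indices used are at least 2,
    so 1 stays fixed. *)
Lemma finW_up_factor j v : (1 <= j <= n)%N -> finW v -> mid_incr v ->
  perm_of v 1 = 1 -> perm_of v N = n%:Z - j%:Z + 2 -> v = up_run j.
Proof.
case: j => // j; elim: j v => [|j IH] v jn Wv vI v1 vN.
  by rewrite up_run1; apply: finW_fix_eq1 => //; rewrite vN /N; lia.
have kn : (1 <= n - j.+1 + 1 <= n)%N by lia.
have vN' : perm_of v N = (n - j.+1 + 1)%N%:Z by rewrite vN; lia.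
have E : (s_ n (n - j.+1 + 1) * v)%g = up_run j.+1.
  apply: IH; first by lia.
  - by apply: parabolicM => //; apply: finW_s.
  - apply: (mid_incr_mulsl (z := N)) => //; first by right.
    by left.
  - rewrite perm_ofM perm_of_s//; last by lia.
    by rewrite v1 refl_fin ?adj_swap_id ?block1//; lia.
  - rewrite perm_ofM perm_of_s//; last by lia.
    by rewrite vN' refl_at//; lia.
rewrite up_runS; last by lia.
by rewrite -E mul_coxgenKg.
Qed.

Lemma finW_mid_incr_run v : finW v -> mid_incr v ->
  exists i j, segment_index n (i, j) /\ v = (down_run i * up_run j)%g.
Proof.
move=> Wv vI; have := finW_block n_gt0 Wv block1; rewrite /in_block => b.
pose i := absz (perm_of v 1 - 1)%R; have i_n : (i <= n)%N by rewrite /i; lia.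
have v1 : perm_of v 1 = i%:Z + 1 by rewrite /i; lia.
have [v' -> [Wv' v'I v'1]] := finW_down_factor i_n Wv vI v1.
have b' := finW_block n_gt0 Wv' blockN; rewrite /in_block in b'.
have ne : perm_of v' N <> 1.
  by rewrite -v'1 => /(perm_of_inj n_gt0); rewrite /N; lia.
(* The second index is read from [v'], not [v], because the down run may have shifted the value at
   [N]; [v'(N) <> 1] gives [j <= n]. *)
pose j := absz (n%:Z + 2 - perm_of v' N)%R.
have jn : (1 <= j <= n)%N by rewrite /j; lia.
exists i, j; split; first by rewrite /segment_index /= i_n.
by rewrite -(@finW_up_factor j v')//; rewrite /j; lia.
Qed.

Lemma perm_mul_s0 u v : let w := (u * v * s_ n 0)%g in
  [/\ perm_of w 1 = perm_of u (perm_of v N) - N,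
      perm_of w N = perm_of u (perm_of v 1) + N
    & forall x, 2 <= x <= n%:Z -> perm_of w x = perm_of u (perm_of v x)].
Proof.
split=> [||x xn]; rewrite !perm_ofM perm_of_s//.
- rewrite refl0_1//; have := perm_of_translate n_gt0 (u * v)%g 0.
  by rewrite add0r !perm_ofM => ->; rewrite addrK.
- by rewrite refl0_N// addrC !perm_of_translate.
- by rewrite refl0_mid.
Qed.

Lemma block_incr_lt g x y : block_incr g -> in_block n x -> in_block n y ->
  (perm_of g x < perm_of g y) = (x < y).
Proof.
move=> gI /andP[x1 xN] /andP[y1 yN]; case: (ltgtP x y) => [xy|yx|->].
- exact: gI.
- by apply/negbTE; rewrite -leNgt ltW//; apply: gI.
- by rewrite ltxx.
Qed.

Lemma block_incr_le g x y : block_incr g -> in_block n x -> in_block n y ->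
  (perm_of g x <= perm_of g y) = (x <= y).
Proof. by move=> gI bx b; rewrite !leNgt block_incr_lt. Qed.

(** The first inequality lets the new first entry stay below [u(1)], the least entry of the window
    of [u]; the second lets the new last entry stay above the greatest, [u(N)]. *)
Lemma affWS_mul_s0 u v : affWS u -> finW v -> mid_incr v ->
  (affWS (u * v * s_ n 0)%g /\ (u * v * s_ n 0)%g != 1%g) <->
  (perm_of u (perm_of v N) < perm_of u 1 + N /\
   perm_of u N - N < perm_of u (perm_of v 1)).
Proof.
move=> /affWSP-/(_ n_gt0) uI Wv vI; have [] := perm_mul_s0 u v.
set w := (u * v * _)%g => w1 wN wx.
have w0 : perm_of w 0 = perm_of u (perm_of v 1).
  by have := perm_of_translate n_gt0 w 0; rewrite add0r wN => /addIr.
have bv x : in_block n x -> in_block n (perm_of v x) by apply: finW_block.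
have bv' x : in_block n x -> in_block n (perm_of v^-1%g x).
  by apply: finW_block => //; apply: parabolicV.
have ge1 x : in_block n x -> perm_of u 1 <= perm_of u x.
  by move=> bx; rewrite block_incr_le ?block1//; case/andP: bx.
have leN x : in_block n x -> perm_of u x <= perm_of u N.
  by move=> bx; rewrite block_incr_le ?blockN//; case/andP: bx.
have b1 := bv _ block1; have bN := bv _ blockN.
split=> [[wS w_neq1]|[c1 c2]].
  have := affWS_descent0 n_gt0 wS w_neq1; rewrite /descent add0r w0 w1 => d0.
  move/(affWSP n_gt0): wS => wI; split.
    (* [p] is the place where [u v] takes its minimum [u(1)]. For [p = 1] the descent at 0 gives the
       bound, for [p = N] it is trivial, and otherwise [w(1) < w(p)] gives it. *)
    have := bv' _ block1; have := perm_ofKV n_gt0 v 1.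
    move: (perm_of v^-1%g 1) => p vp /andP[p1 pN].
    have [p_1|p_1] := eqVneq p 1; first by rewrite -p_1 in d0; move: d0; rewrite vp; lia.
    have [p_N|p_N] := eqVneq p N; first by rewrite -p_N vp ltrDl.
    have := wI 1 p; rewrite w1 wx ?vp; [|rewrite /N in p_N pN; lia].
    by rewrite ltrBlDr; apply => //; lia.
  (* The same argument at the place of the maximum [u(N)]. *)
  have := bv' _ blockN; have := perm_ofKV n_gt0 v N.
  move: (perm_of v^-1%g N) => p vp /andP[p1 pN].
  have [p_N|p_N] := eqVneq p N; first by rewrite -p_N in d0; move: d0; rewrite p_N -{1}p_N vp; lia.
  have [p_1|p_1] := eqVneq p 1; first by rewrite -p_1 vp ltrBlDr ltrDl.
  have := wI p N; rewrite wN wx ?vp; [|rewrite /N in p_N pN; lia].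
  by rewrite ltrBlDr; apply => //; lia.
have := ge1 _ b1; have := ge1 _ bN; have := leN _ b1; have := leN _ bN => *.
split; last first.
  (* If [w] were 1, then [u(v(1)) = 0] and [u(v(N)) = N + 1]; the former gives [u(1) <= 0], against
     [c1]. *)
  apply/eqP => w_eq1; move: w0 w1; rewrite w_eq1 !perm_of1; lia.
apply/(affWSP n_gt0); apply: increasing_range => x x1 xN.
have [x_1|x_1] := eqVneq x 1.
  have [x_n|x_n] := eqVneq (x + 1) N.
    by rewrite x_n x_1 w1 wN; have : 0 < N by []; lia.
  rewrite x_1 w1 wx; last by rewrite /N in xN x_n; lia.
  have := ge1 (perm_of v (1 + 1)); rewrite ltrBlDr => le.
  apply: lt_le_trans c1 _; rewrite lerD2r; apply/le/bv.
  by rewrite /in_block; lia.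
have [x_n|x_n] := eqVneq (x + 1) N.
  rewrite x_n wN wx; last by rewrite /N in x_n; lia.
  rewrite -ltrBlDr; apply: le_lt_trans c2; rewrite lerD2r; apply/leN/bv.
  by rewrite /in_block; rewrite /N in xN; lia.
rewrite /N in xN x_n; rewrite !wx; [|lia|lia].
by rewrite block_incr_lt ?bv ?vI// /in_block; lia.
Qed.

End Segments.

(** * Allowed pairs and the canonical factorization *)

Section CanonicalFactorization.
Import Order.TTheory GRing.Theory Num.Theory.
Local Open Scope ring_scope.
Variable n : nat.
Hypothesis n_gt0 : (0 < n)%N.
Implicit Types (u v w x : affW n) (i j k l : nat) (r : seq (nat * nat)).

Let N : int := n.+1%:Z.
Let perm_ofM := perm_ofM n_gt0.
Let perm_of1 := perm_of1 n_gt0.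

Lemma segment_indexP i j :
  segment_index n (i, j) -> (i <= n)%N /\ (1 <= j <= n)%N.
Proof. by move/andP. Qed.

(** The three alternatives regroup into one condition on [i, k] and one on [j, l], because [i <= k],
    [j <= l] and [i + j > n] imply [k + l > n]. *)
Lemma allowed_pairE i j k l :
  allowed_pair n (i, j) (k, l) =
  ((i < k) || (i == k) && (n < i + j))%N &&
  ((j < l) || (j == l) && (n < k + l))%N.
Proof. by rewrite /allowed_pair; lia. Qed.

(** The tie [p = i + 1] is the delicate case: the down run lowers [p] below [f 1] unless the up run
    has first moved it to [i + 2], which happens iff [i + j > n]. *)
Lemma perm_run_lt i j (p : int) : (i <= n)%N -> (1 <= j <= n)%N ->
  2 <= p <= n%:Z ->
  let f := perm_of (down_run n i * up_run n j)%g in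
  (f 1 < f p) = (i%:Z < p - 1) || (i%:Z == p - 1) && (n < i + j)%N /\
  (f p < f N) = (p < n%:Z - j%:Z + 2).
Proof.
move=> i_n jn pn f.
have bp : in_block n p by rewrite /in_block; lia.
have -> : f 1 = i%:Z + 1 by rewrite /f perm_run1.
rewrite /f !perm_ofM.
have Wj := finW_up_run n_gt0 jn; have bN := blockN n_gt0.
have := perm_down_run n_gt0 i_n (finW_block n_gt0 Wj bp).
have := perm_down_run n_gt0 i_n (finW_block n_gt0 Wj bN).
have := perm_up_run n_gt0 jn bp; have := perm_up_run n_gt0 jn bN.
rewrite -/N; have : N = n%:Z + 1 by rewrite /N; lia.
lia.
Qed.

(** The up run sends [N] to [n - l + 2], and the down run lowers this by one iff it is at most
    [k + 1]. *)
Lemma perm_runN k l : (k <= n)%N -> (1 <= l <= n)%N ->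
  perm_of (down_run n k * up_run n l)%g N = n%:Z - l%:Z + 2 - (n < k + l)%N%:Z.
Proof.
move=> kn ln; rewrite perm_ofM.
have := perm_down_run n_gt0 kn (finW_block n_gt0 (finW_up_run n_gt0 ln) (blockN n_gt0)).
have := perm_up_run n_gt0 ln (blockN n_gt0); rewrite -/N; lia.
Qed.

Lemma affWS_step x i j k l : affWS x ->
  segment_index n (i, j) -> segment_index n (k, l) ->
  let u := (x * segment n i j)%g in
  affWS u -> u != 1%g ->
  (affWS (u * segment n k l)%g /\ (u * segment n k l)%g != 1%g) <->
  allowed_pair n (i, j) (k, l).
Proof.
move=> xS /segment_indexP[i_n jn] /segment_indexP[kn ln] u uS u_neq1.
have Wij := finW_run n_gt0 i_n jn; have Iij := mid_incr_run n_gt0 i_n jn.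
have xI := (affWSP n_gt0 x).1 xS; have uI := (affWSP n_gt0 u).1 uS.
have uE : u = (x * (down_run n i * up_run n j) * s_ n 0)%g.
  by rewrite /u segmentE !mulgA.
have uP : affWS u /\ u != 1%g by [].
rewrite uE in uP; case/(affWS_mul_s0 n_gt0 xS Wij Iij): uP => c1 c2.
have [u1 uN ux] := perm_mul_s0 n_gt0 x (down_run n i * up_run n j)%g.
rewrite -uE -/N in u1 uN ux c1 c2.
rewrite segmentE !mulgA -(mulgA u).
rewrite (affWS_mul_s0 n_gt0 uS (finW_run n_gt0 kn ln) (mid_incr_run n_gt0 kn ln)).
(* [q] is the value at [N] of the finite part of the second segment. *)
pose q : int := n%:Z - l%:Z + 2 - (n < k + l)%N%:Z.
rewrite -/N perm_run1// perm_runN// -/q u1 uN subrK addrK allowed_pairE.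
rewrite perm_run1// in c2 *; rewrite [andb _ _]andbC.
suff [-> ->] : (perm_of x (i%:Z + 1) < perm_of u (k%:Z + 1))
      = ((i < k) || (i == k) && (n < i + j))%N
   /\ (perm_of u q < perm_of x (perm_of (down_run n i * up_run n j)%g N))
      = ((j < l) || (j == l) && (n < k + l))%N.
  by split=> [[-> ->]|/andP].
have N_E : N = n%:Z + 1 by rewrite /N; lia.
set v := (_ * _)%g in Wij Iij uE u1 uN ux c1 c2 *.
have v1 : perm_of v 1 = i%:Z + 1 by rewrite /v perm_run1.
have b1 := finW_block n_gt0 Wij (block1 n_gt0).
have bN := finW_block n_gt0 Wij (blockN n_gt0).
have bv (p : int) : 2 <= p <= n%:Z -> in_block n (perm_of v p).
  by move=> pn; apply: finW_block => //; rewrite /in_block; lia.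
have le1 : perm_of x 1 <= perm_of x (i%:Z + 1).
  by rewrite -v1 block_incr_le ?block1//; case/andP: b1.
have leN : perm_of x (perm_of v N) <= perm_of x N.
  by rewrite block_incr_le ?blockN//; case/andP: bN.
split.
  (* At [k = 0] or [k = n] the entry of [u] is an end of its window, a value of [x] shifted by [N],
     so the comparison is decided by [c1] or by [N > 0]. The extreme values of [q] below are
     similar. *)
  have [k0|k_gt0] := posnP k; first by rewrite k0 add0r u1; lia.
  have [kn'|k_ltn] : k%:Z + 1 = N \/ (k < n)%N by lia.
    by rewrite kn' uN v1 ltrDl; lia.
  have pn : 2 <= k%:Z + 1 <= n%:Z by lia.
  rewrite (ux _ pn) -v1 (block_incr_lt xI b1 (bv _ pn)).
  by have [-> _] := perm_run_lt i_n jn pn; rewrite addrK; lia.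
have [q1|[qN|qn]] : q = 1 \/ q = N \/ 2 <= q <= n%:Z by rewrite /q; lia.
- by rewrite q1 u1; lia.
- by rewrite qN uN v1; lia.
rewrite (ux _ qn) (block_incr_lt xI (bv _ qn) bN).
by have [_ ->] := perm_run_lt i_n jn qn; rewrite /q; lia.
Qed.

Lemma sorted_rcons2 (T : Type) (e : rel T) s y z :
  sorted e (rcons (rcons s y) z) = sorted e (rcons s y) && e y z.
Proof. by case: s => [|a s] /=; rewrite ?andbT// rcons_path last_rcons. Qed.

(** Inversion with [w = u * segment n i j]; the length condition is automatic by [len_parabolic]. *)
Lemma is_canonicalP w r : is_canonical w r <->
  (w = 1%g /\ r = [::]) \/
  exists u i j r', [/\ r = rcons r' (i, j), is_canonical u r', affWS u,
    segment_index n (i, j) & [/\ w = (u * segment n i j)%g, affWS w & w != 1%g]].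
Proof.
split=> [|[[-> ->]|]]; first 1 last.
- exact: is_canonical_id.
- move=> [u [i [j [r' [-> ur uS ij [wE wS w1]]]]]].
  have [i_n jn] := segment_indexP ij; have Wv := finW_run n_gt0 i_n jn.
  have ws0 : (w * s_ n 0)%g = (u * (down_run n i * up_run n j))%g.
    by rewrite wE segmentE !mulgA mulg_coxgenK.
  apply: (is_canonical_step wS w1 uS Wv ws0 _ ij _ ur) => //.
  by rewrite ws0 len_parabolic//; apply/affWSP.
case=> [|{}w u v i j {}r wS w1 uS Wv E lenE ij vE ur]; first by left.
right; exists u, i, j, r; split=> //; split=> //.
by rewrite -vE mulgA -E mulg_coxgenK.
Qed.

Lemma is_canonical_affWS w r : is_canonical w r -> affWS w.
Proof.
case/is_canonicalP=> [[-> _]|[u [i [j [r' [_ _ _ _ []]]]]]//].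
by apply/(affWSP n_gt0) => y z _ yz _; rewrite !perm_of1.
Qed.

(** After the empty product every segment is admissible; otherwise only the last pair matters, by
    [affWS_step]. *)
Lemma is_canonical_rcons u r k l : is_canonical u r ->
  sorted (allowed_pair n) r -> segment_index n (k, l) ->
  (affWS (u * segment n k l)%g /\ (u * segment n k l)%g != 1%g) <->
  sorted (allowed_pair n) (rcons r (k, l)).
Proof.
move=> ur r_sorted kl; have [kn ln] := segment_indexP kl.
have uS := is_canonical_affWS ur.
case/is_canonicalP: ur r_sorted uS => [[-> ->] _ uS|].
  split=> // _; rewrite segmentE mulgA.
  apply/(affWS_mul_s0 n_gt0 uS (finW_run n_gt0 kn ln) (mid_incr_run n_gt0 kn ln)).
  by rewrite perm_run1// perm_runN// !perm_of1 subrr; lia.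
move=> [x [i [j [r' [-> _ xS ij [-> uS u1]]]]]] r_sorted _.
by rewrite sorted_rcons2 r_sorted; apply: affWS_step.
Qed.

Lemma is_canonical_sound w r : is_canonical w r ->
  allowed_products n r /\ len w = (\sum_(p <- r) (p.1 + p.2))%N.
Proof.
elim/last_ind: r w => [|r [i j] IH] w /is_canonicalP[[wE rE]|].
- by split=> //; rewrite wE big_nil /len coxlen1.
- by move=> [u [i [j [r' [/(congr1 size)]]]]]; rewrite size_rcons.
- by move/(congr1 size): rE; rewrite size_rcons.
move=> [u [i' [j' [r' [/rcons_inj[<- <- <-] ur uS ij [wE wS w1]]]]]].
have [i_n jn] := segment_indexP ij.
have [/andP[r_idx r_sorted] lenu] := IH _ ur; split.
  apply/andP; split; first by rewrite all_rcons ij.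
  by apply/(is_canonical_rcons ur) => //; rewrite -wE.
(* The run contributes [i + j - 1] to the length of [w s_0]; the descent of [w] at 0 contributes the
   last unit. *)
rewrite -cats1 big_cat big_seq1 /= -lenu -(len_run n_gt0 i_n jn) addnS.
rewrite -len_parabolic//; [|exact/affWSP|exact: finW_run].
have -> : (u * (down_run n i * up_run n j) = w * coxgen _ ord0)%g.
  have -> : coxgen (@affA_mx n) ord0 = s_ n 0.
    by congr coxgen; apply/val_inj; rewrite /= inordK.
  by rewrite wE segmentE !mulgA mulg_coxgenK.
by apply: len_descent => //; apply: affWS_descent0.
Qed.

(** Cancelling [s_0] leaves two coset decompositions of one element, so [u] and the run agree, and
    the run determines its indices. *)
Lemma is_canonical_fun w r r' : is_canonical w r -> is_canonical w r' -> r = r'.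
Proof.
elim/last_ind: r w r' => [|r [i j] IH] w r'.
  case/is_canonicalP=> [[-> _]|[u [i [j [r2 [/(congr1 size)]]]]]]; last first.
    by rewrite size_rcons.
  case/is_canonicalP=> [[_ ->]//|[u [i [j [r2 [_ _ _ _ [_ _]]]]]]].
  by rewrite eqxx.
case/is_canonicalP=> [[_ /(congr1 size)]|]; first by rewrite size_rcons.
move=> [u [i' [j' [r2 [/rcons_inj[<- <- <-] ur uS ij [wE wS w1]]]]]].
case/is_canonicalP=> [[wE1]|]; first by rewrite wE1 eqxx in w1.
move=> [u' [k [l [r3 [-> ur' uS' kl [wE' _ _]]]]]].
have [i_n jn] := segment_indexP ij; have [kn ln] := segment_indexP kl.
move: wE'; rewrite wE !segmentE !mulgA => /mulIg; rewrite -!mulgA => E.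
have [uu' vv'] := affWS_finW_uniq n_gt0 uS uS' (finW_run n_gt0 i_n jn)
  (finW_run n_gt0 kn ln) E.
have [-> ->] := run_inj n_gt0 i_n jn kn ln vv'.
by rewrite (IH u r3)//; rewrite uu'.
Qed.

Lemma is_canonical_exists w : affWS w -> exists r, is_canonical w r.
Proof.
have [m] := ubnP (len w); elim: m w => // m IH w wm wS.
have [->|w1] := eqVneq w 1%g; first by exists [::]; apply: is_canonical_id.
have [u [v [uS Wv E]]] := affWS_finW_decomp n_gt0 (w * s_ n 0)%g.
have uI := (affWSP n_gt0 u).1 uS.
have d0 : descent w (inord 0 : 'I_n.+1)%:Z.
  by rewrite inordK//; apply: affWS_descent0.
(* On [2, ..., n] the product [u v = w s_0] agrees with the increasing [w], and [u] reflects the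
   order of the window. *)
have vI : mid_incr v.
  move=> y z y2 yz zn.
  have [by_ bz] : in_block n y /\ in_block n z by rewrite /in_block; lia.
  rewrite -(block_incr_lt uI); try exact: finW_block.
  rewrite -!perm_ofM -E !perm_ofM !perm_of_s// !refl0_mid//; try lia.
  by apply: (affWSP n_gt0 w).1 => //; lia.
have [i [j [ij vE]]] := finW_mid_incr_run n_gt0 Wv vI.
have wE : w = (u * segment n i j)%g.
  by rewrite segmentE -vE mulgA -E mulg_coxgenK.
have [|//|r ur] := IH u _.
  have := len_descent n_gt0 d0; rewrite -/(s_ n 0) E len_parabolic//; lia.
exists (rcons r (i, j)); apply/is_canonicalP; right.
by exists u, i, j, r.
Qed.

Lemma is_canonical_complete r : allowed_products n r ->
  exists w, is_canonical w r.
Proof.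
elim/last_ind: r => [|r [k l] IH]; first by exists 1%g; apply: is_canonical_id.
rewrite /allowed_products /= all_rcons => /andP[/andP[kl r_idx] rs].
have r_sorted : sorted (allowed_pair n) r.
  by move: rs; rewrite -cats1 => /cat_sorted2[].
have [|u ur] := IH; first exact/andP.
have [wS w1] := (is_canonical_rcons ur r_sorted kl).2 rs.
exists (u * segment n k l)%g; apply/is_canonicalP; right.
by exists u, k, l, r; split=> //; apply: is_canonical_affWS ur.
Qed.

Lemma canonical_factorizationP w : affWS w ->
  is_canonical w (canonical_factorization w).
Proof.
by move=> wS; apply: (xgetPex [::]); apply: is_canonical_exists.
Qed.

Lemma is_canonical_inj w w' r : is_canonical w r -> is_canonical w' r -> w = w'.
Proof.
elim/last_ind: r w w' => [|r [i j] IH] w w'.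
  case/is_canonicalP=> [[-> _]|[u [i [j [r2 [/(congr1 size)]]]]]]; last first.
    by rewrite size_rcons.
  case/is_canonicalP=> [[-> _]//|[u [i [j [r2 [/(congr1 size)]]]]]].
  by rewrite size_rcons.
case/is_canonicalP=> [[_ /(congr1 size)]|]; first by rewrite size_rcons.
move=> [u [i' [j' [r2 [/rcons_inj[<- <- <-] ur _ _ [-> _ _]]]]]].
case/is_canonicalP=> [[_ /(congr1 size)]|]; first by rewrite size_rcons.
move=> [u' [i2 [j2 [r3 [/rcons_inj[<- <- <-] ur' _ _ [-> _ _]]]]]].
by rewrite (IH _ _ ur ur').
Qed.

End CanonicalFactorization.

Theorem theorem9p5 (n : nat) (n_gt0 : 0 < n) :
  [/\ (forall w : affW n, affWS w ->
         forall r, is_canonical w r <-> r = canonical_factorization w),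
      set_bij (@affWS n) (@allowed_products n) (@canonical_factorization n)
    & (forall w : affW n, affWS w ->
         len w = \sum_(p <- canonical_factorization w) (p.1 + p.2))].
Proof.
have cfP := canonical_factorizationP n_gt0.
have cfE (w : affW n) r : affWS w -> is_canonical w r <-> r = canonical_factorization w.
  move=> wS; split=> [wr|->]; last exact: cfP.
  exact: (is_canonical_fun n_gt0 wr (cfP w wS)).
split=> [w wS r||w wS]; first exact: cfE.
  split=> [w /cfP/(is_canonical_sound n_gt0)[]//|w w'|r].
    rewrite !inE => /cfP wr /cfP wr' E; rewrite -E in wr'.
    exact: is_canonical_inj wr wr'.
  move=> /(is_canonical_complete n_gt0)[w wr].
  have wS := is_canonical_affWS n_gt0 wr.
  by exists w => //; apply/esym/cfE.
by have [] := is_canonical_sound n_gt0 (cfP w wS).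
Qed.
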